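(* Let $P$ be a poset. If $(P,\sigma(P))$ is first-countable, then $\sigma(\Gamma(P))=\upsilon(\Gamma(P))$.
   Context: For a poset $P$, a subset $A\subseteq P$ is Scott closed if it is a lower set and for every directed $D\subseteq A$ whose supremum $\bigvee D$ exists in $P$ one has $\bigvee D\in A$. The Scott topology $\sigma(P)$ consists of the complements of Scott closed sets. $\Gamma(P)$ is the complete lattice of all Scott closed subsets of $P$ (including $\emptyset$), ordered by inclusion, and $\sigma(\Gamma(P))$ is the Scott topology of this poset. The lower Vietoris topology $\upsilon(\Gamma(P))$ on $\Gamma(P)$ is generated by the subbase of sets $\Diamond U=\{A\in\Gamma(P): A\cap U\neq\emptyset\}$, $U\in\sigma(P)$. *)

(* Defs.v *)
From HB Require Import structures.
From mathcomp Require Import all_boot all_order.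
From mathcomp Require Import all_classical.
From mathcomp Require Import topology.

Set Implicit Arguments.
Unset Strict Implicit.
Unset Printing Implicit Defensive.

Import Order.TTheory.

Local Open Scope classical_set_scope.
Local Open Scope order_scope.

Definition first_countable (T : topologicalType) : Prop :=
  forall x : T, exists B : set (set T),
    [/\ countable B, B `<=` nbhs x &
        forall U, nbhs x U -> exists2 V, B V & V `<=` U].

Section ScottClosed.
Context {d : Order.disp_t} {P : porderType d}.

Definition lower_set (A : set P) : Prop :=
  forall x y, x <= y -> A y -> A x.

Definition directed (D : set P) : Prop :=
  D !=set0 /\ forall x y, D x -> D y -> exists z, [/\ D z, x <= z & y <= z].

Definition scott_closed (A : set P) : Prop :=
  lower_set A /\
  forall (D : set P) (s : P), directed D -> D `<=` A -> isLub D s -> A s.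

Definition scott_open (U : set P) : Prop := scott_closed (~` U).

Lemma scott_openT : scott_open setT.
Proof. by rewrite /scott_open setCT; split=> // D s [[x Dx] _] /(_ x Dx). Qed.

Lemma scott_openI : setI_closed scott_open.
Proof.
move=> U V [lU cU] [lV cV]; rewrite /scott_open setCI; split.
  by move=> x y xy [/(lU _ _ xy)|/(lV _ _ xy)]; [left|right].
move=> D s [D0 dirD] DUV lubs; apply: contrapT => /not_orP[nUs nVs].
have [u [Du Uu]] : exists u, D u /\ U u.
  apply: contrapT => nU; apply: nUs; apply: (cU D) => // x Dx Ux.
  by apply: nU; exists x.
have [v [Dv Vv]] : exists v, D v /\ V v.
  apply: contrapT => nV; apply: nVs; apply: (cV D) => // x Dx Vx.
  by apply: nV; exists x.
have [z [Dz uz vz]] := dirD u v Du Dv.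
by case: (DUV z Dz) => [nUz|nVz]; [apply: (lU u z)|apply: (lV v z)].
Qed.

Lemma scott_open_bigU (I : Type) (f : I -> set P) :
  (forall i, scott_open (f i)) -> scott_open (\bigcup_i f i).
Proof.
move=> of_; rewrite /scott_open setC_bigcup; split.
  by move=> x y xy fy i _; have [lo _] := of_ i; exact: lo xy (fy i Logic.I).
move=> D s dirD Df lubs i _; have [_ cl] := of_ i; apply: cl lubs => // x Dx.
exact: Df.
Qed.

End ScottClosed.

(* A type synonym, so that the Scott topology does not clash with a topology P
   may already carry. *)
Definition scott {d : Order.disp_t} (P : porderType d) : Type := P.

HB.instance Definition _ d (P : porderType d) := Choice.on (scott P).
HB.instance Definition _ d (P : porderType d) :=
  isOpenTopological.Build (scott P)
    (@scott_openT d P) (@scott_openI d P) (@scott_open_bigU d P).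

(* The order is the restriction of the library's order on [set P], which is
   inclusion. *)
Definition Gamma {d : Order.disp_t} (P : porderType d) : Type :=
  {A : set P | `[< scott_closed A >]}.

HB.instance Definition _ d (P : porderType d) := SubChoice.on (Gamma P).
HB.instance Definition _ d (P : porderType d) :=
  [SubChoice_isSubPOrder of Gamma P by <: with set_display].

Definition diamond {d : Order.disp_t} {P : porderType d} (U : set P) :
    set (Gamma P) :=
  [set A | \val A `&` U !=set0].

Definition vietoris {d : Order.disp_t} (P : porderType d) : Type := Gamma P.

HB.instance Definition _ d (P : porderType d) := Choice.on (vietoris P).
HB.instance Definition _ d (P : porderType d) :=
  isSubBaseTopological.Build (vietoris P)
    (open : set (set (scott P))) (@diamond d P).

Definition scott_topology {d : Order.disp_t} (P : porderType d) :
    set (set P) :=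
  @open (scott P).

Definition lower_vietoris_topology {d : Order.disp_t} (P : porderType d) :
    set (set (Gamma P)) :=
  @open (vietoris P).

Arguments scott_topology {d} P.
Arguments lower_vietoris_topology {d} P.

(* Main.v *)
Require Import Defs.
From mathcomp Require Import all_boot all_order.
From mathcomp Require Import all_classical.
From mathcomp Require Import topology.

(** Each subbasic set [diamond U] is Scott open because its complement is the
    principal ideal of the closed set [~` U]; so the lower Vietoris topology is
    always coarser than the Scott topology of [Gamma P].

    For the converse, let [H] be Scott open in [Gamma P] and [H A]. As [A] is the
    directed supremum of the lower sets generated by its finite subsets
    ([scott_open_downs]), [H] contains such a lower set [downs s] with
    [downs s <= A], and Vietoris open sets are upper sets; so it is enough to
    find a Vietoris neighbourhood of [downs s] inside [H]. What is proved, by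
    induction on [s], is stronger and uniform in [H]: there is one decreasing
    sequence [N] of Vietoris open neighbourhoods of [downs s] such that every
    Scott open set containing [downs s] contains some [N k] ([downs_base]).

    In the inductive step ([gammaU_base]) a point [x] with a decreasing countable
    base [U] is joined to a closed set [B] that already has such a sequence [N];
    the new sequence is [diamond (U k) `&` N k]. If no term of it lies in [H],
    choose [C k] in the [k]-th term outside [H], and [y k] in both [C k] and
    [U k]. The points [y k] converge to [x]. The join is Scott continuous in each
    variable, so the points [z] whose ideal joined to [B] lies in [H] form an
    open neighbourhood of [x], which for some [n] contains [x] and all [y m] with
    [n <= m]. These points form a compact set [K], and compactness makes the
    closed sets whose join with the ideal of each point of [K] lies in [H] a
    Scott open set ([scott_open_sequence]). It contains [B], hence some [N k],
    hence [C m] for [m = maxn n k]; but the join of [C m] with the ideal of [y m]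
    is [C m] itself, which is not in [H]. Compactness is what turns the separate
    continuity of the join into the joint continuity that the induction
    requires. *)

Set Implicit Arguments.
Unset Strict Implicit.
Unset Printing Implicit Defensive.

Import Order.TTheory.

Set Bullet Behavior "Strict Subproofs".

Local Open Scope classical_set_scope.
Local Open Scope order_scope.

(** * Scott open sets *)

Section ScottOpen.
Context {d : Order.disp_t} {P : porderType d}.

Lemma scott_openP (U : set P) :
  scott_open U <->
  (forall x y, x <= y -> U x -> U y) /\
  (forall D s, directed D -> isLub D s -> U s -> exists2 x, D x & U x).
Proof.
split=> [[lU cU]|[uU iU]]; split.
- by move=> x y xy Ux; apply: contrapT => /(lU x y xy); apply.
- move=> D s dirD lubs Us; apply: contrapT => nDU.
  by apply: (cU D s dirD _ lubs) => // x Dx Ux; apply: nDU; exists x.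
- by move=> x y xy nUy /(uU x y xy).
- by move=> D s dirD DU lubs /(iU D s dirD lubs)[x /DU].
Qed.

Lemma scott_closedC (A : set P) : scott_open (~` A) = scott_closed A.
Proof. by rewrite /scott_open setCK. Qed.

Lemma scott_closedU (A B : set P) :
  scott_closed A -> scott_closed B -> scott_closed (A `|` B).
Proof. by rewrite -!scott_closedC setCU; exact: scott_openI. Qed.

Lemma scott_closed_down (x : P) : scott_closed [set y | y <= x].
Proof.
split=> [y z yz /=|D s _ Dx [_ lub]]; first exact: le_trans.
exact: lub.
Qed.

Lemma scott_closed0 : scott_closed (set0 : set P).
Proof. by split=> // D s [[x Dx] _] /(_ x Dx). Qed.

(** This is the finite subcover step in the compactness argument of
    [scott_open_sequence]: the elements of [D] found for each [Q m] have a
    common upper bound in [D]. *)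
Lemma directed_finite (D : set P) (Q : nat -> set P) (k : nat) :
  directed D -> (forall m x y, x <= y -> Q m x -> Q m y) ->
  (forall m, exists2 x, D x & Q m x) ->
  exists2 x, D x & forall m, (m < k)%N -> Q m x.
Proof.
move=> [[x0 Dx0] dirD] uQ DQ; elim: k => [|k [x Dx Qx]]; first by exists x0.
have [y Dy Qy] := DQ k; have [z [Dz xz yz]] := dirD x y Dx Dy.
exists z => // m; rewrite ltnS leq_eqVlt => /predU1P[->|mk].
  exact: uQ yz Qy.
by apply: uQ xz _; exact: Qx.
Qed.

End ScottOpen.

Definition scott_continuous {d d'} {P : porderType d} {Q : porderType d'}
    (f : P -> Q) : Prop :=
  {homo f : x y / x <= y} /\
  forall D s, directed D -> isLub D s -> isLub (f @` D) (f s).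

Lemma scott_open_preimage {d d'} {P : porderType d} {Q : porderType d'}
    (f : P -> Q) (U : set Q) :
  scott_continuous f -> scott_open U -> scott_open (f @^-1` U).
Proof.
move=> [mf lf] /scott_openP[uU iU]; apply/scott_openP.
split=> [x y xy|D s dirD]; first exact/uU/mf.
move=> lubs Us; have [] := iU (f @` D) (f s) _ (lf _ _ dirD lubs) Us; last first.
  by move=> _ [x Dx <-] Ux; exists x.
case: dirD => -[x Dx] dirD; split; first by exists (f x), x.
move=> _ _ [y Dy <-] [z Dz <-]; have [t [Dt yt zt]] := dirD y z Dy Dz.
by exists (f t); split; [exists t|exact: mf|exact: mf].
Qed.

(** * The lattice of Scott closed sets *)

Section Gamma.
Context {d : Order.disp_t} {P : porderType d}.
Implicit Types (A B C : Gamma P) (H : set (Gamma P)).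

Definition to_gamma (A : set P) (cA : scott_closed A) : Gamma P :=
  exist _ A (asboolT cA).

Lemma gamma_closed A : scott_closed (\val A).
Proof. exact/asboolP/(valP A). Qed.

(** The order on [Gamma P] is declared through the order of the type of sets;
    this lemma exposes it as inclusion. *)
Lemma gamma_leP A B : reflect (\val A `<=` \val B) (A <= B).
Proof. by apply: (iffP idP); rewrite leEsub subsetEset. Qed.

Definition gamma0 : Gamma P := to_gamma scott_closed0.

Definition down (x : P) : Gamma P := to_gamma (scott_closed_down x).

Definition gammaU A B : Gamma P :=
  to_gamma (scott_closedU (gamma_closed A) (gamma_closed B)).

Lemma down_le x A : (down x <= A) <-> \val A x.
Proof.
split=> [/gamma_leP/(_ x)|Ax]; first by apply; rewrite /= lexx.
by apply/gamma_leP => y yx; have [lA _] := gamma_closed A; exact: lA yx Ax.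
Qed.

Lemma gamma0_le A : gamma0 <= A.
Proof. by apply/gamma_leP => x []. Qed.

Lemma gammaU_le A B C : (gammaU A B <= C) = (A <= C) && (B <= C).
Proof.
apply/gamma_leP/andP => [ABC|[/gamma_leP AC /gamma_leP BC] x [/AC|/BC]//].
by split; apply/gamma_leP => x ?; apply: ABC; [left|right].
Qed.

Lemma gammaU_mono A A' B B' :
  A <= A' -> B <= B' -> gammaU A B <= gammaU A' B'.
Proof.
have := lexx (gammaU A' B'); rewrite gammaU_le => /andP[AU BU] AA' BB'.
by rewrite gammaU_le (le_trans AA') ?(le_trans BB').
Qed.

(** No closure has to be computed: the supremum of the sets [gammaU A B], for
    [B] in a nonempty [D], is compared with upper bounds only, and an upper
    bound of these is just an upper bound of [D] that lies above [A]. *)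
Lemma gammaU_continuous A : scott_continuous (gammaU A).
Proof.
split=> [B B' BB'|D S [[B0 DB0] _] [ubS leS]]; first exact: gammaU_mono.
split=> [_ [B DB <-]|C ubC]; first exact/gammaU_mono/ubS.
have := ubC _ (ex_intro2 _ _ B0 DB0 erefl); rewrite !gammaU_le.
move=> /andP[-> _] /=; apply: leS => B DB.
by have := ubC _ (ex_intro2 _ _ B DB erefl); rewrite gammaU_le => /andP[].
Qed.

(** The supremum in [Gamma P] of the principal ideals of a directed set is the
    principal ideal of its supremum whenever the latter exists, because upper
    bounds in [Gamma P] are Scott closed. *)
Lemma down_gammaU_continuous B : scott_continuous (fun x => gammaU (down x) B).
Proof.
split=> [x y xy|D s dirD lubs].
  by apply: gammaU_mono => //; apply/down_le.
split=> [_ [x Dx <-]|C ubC].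
  by apply: gammaU_mono => //; apply/down_le; case: lubs => /(_ x Dx).
have [[x0 Dx0] _] := dirD.
have leC x : D x -> (down x <= C) && (B <= C).
  by move=> Dx; rewrite -gammaU_le; apply: ubC; exists x.
rewrite gammaU_le; have /andP[_ ->] := leC x0 Dx0; rewrite andbT.
apply/down_le; have [_ cC] := gamma_closed C.
by apply: (cC D s) => // x /leC /andP[/down_le].
Qed.

Definition downs (s : seq P) : Gamma P :=
  foldr (fun x => gammaU (down x)) gamma0 s.

Lemma downs_le s A : (downs s <= A) <-> {in s, forall x, \val A x}.
Proof.
elim: s => [|x s IHs] /=; first by split=> // _; exact: gamma0_le.
rewrite gammaU_le; split=> [/andP[/down_le Ax /IHs As] y|Axs].
  by rewrite inE => /predU1P[->//|/As].
apply/andP; split; first by apply/down_le/Axs; rewrite mem_head.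
by apply/IHs => y sy; apply: Axs; rewrite inE sy orbT.
Qed.

(** Every Scott closed set is the directed supremum of the finitely generated
    lower sets it contains: [s ++ t] generates a common upper bound, and the
    singletons already give back all the points. *)
Lemma scott_open_downs H A :
  scott_open H -> H A -> exists2 s, H (downs s) & downs s <= A.
Proof.
move=> /scott_openP[_ iH] HA.
pose D : set (Gamma P) := [set downs s | s in [set s | downs s <= A]].
suff [dirD lubA] : directed D /\ isLub D A.
  by have [_ [s sA <-] Hs] := iH D A dirD lubA HA; exists s.
split; split.
- by exists (downs [::]), [::] => //; exact: gamma0_le.
- move=> _ _ [s /downs_le sA <-] [t /downs_le tA <-].
  have /downs_le st := lexx (downs (s ++ t)); exists (downs (s ++ t)); split.
  + exists (s ++ t) => //; apply/downs_le => x.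
    by rewrite mem_cat => /orP[/sA|/tA].
  + by apply/downs_le => x sx; apply: st; rewrite mem_cat sx.
  + by apply/downs_le => x tx; apply: st; rewrite mem_cat tx orbT.
- by move=> _ [s sA <-].
- move=> C ubC; apply/gamma_leP => x Ax.
  have DX : D (downs [:: x]).
    by exists [:: x] => //; apply/downs_le => y; rewrite inE => /eqP->.
  by have /downs_le := ubC _ DX; apply; rewrite mem_head.
Qed.

(** * Vietoris open sets are Scott open *)

(** If [S] is the supremum of [D] and no member of [D] meets [U], the closed set
    [~` U] is an upper bound of [D]; so [S] does not meet [U] either. *)
Lemma scott_open_diamond (U : set P) :
  scott_open U -> scott_open (diamond U : set (Gamma P)).
Proof.
move=> oU; apply/scott_openP; split.
  by move=> A B /gamma_leP AB [x [Ax Ux]]; exists x; split=> //; exact: AB.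
move=> D S _ [_ leS] [x [Sx Ux]]; apply: contrapT => nD.
have cU : scott_closed (~` U) by [].
have /leS/gamma_leP/(_ x Sx) : ubound D (to_gamma cU).
  move=> B DB; apply/gamma_leP => y By Uy.
  by apply: nD; exists B => //; exists y.
exact.
Qed.

Lemma vietoris_open_diamond (U : set P) :
  scott_open U -> lower_vietoris_topology P (diamond U).
Proof.
move=> oU; exists [set diamond U]; last by rewrite bigcup_set1.
by move=> _ ->; apply: finI_from1.
Qed.

Lemma vietoris_scott_open H : lower_vietoris_topology P H -> scott_open H.
Proof.
move=> [D DI <-]; rewrite -[scott_open _]/(@open (scott (Gamma P)) _).
apply: bigcup_open => _ /DI[F FO <-].
rewrite openE => A FA; apply: filter_bigI => U FU.
apply: (@open_nbhs_nbhs (scott (Gamma P))); split; last exact: FA.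
by apply: scott_open_diamond; have := FO _ FU; rewrite inE.
Qed.

End Gamma.

(** * Decreasing countable bases *)

(** Two families of open sets occur because the base sought on [Gamma P]
    consists of sets open for the coarser Vietoris topology, while it has to
    refine all neighbourhoods for the finer Scott topology. *)
Definition decreasing_base {T : Type} (O O' : set (set T)) (x : T)
    (U : nat -> set T) : Prop :=
  [/\ forall k, O (U k) /\ U k x,
      forall j k, (j <= k)%N -> U k `<=` U j &
      forall V, O' V -> V x -> exists k, U k `<=` V].

Lemma first_countable_base (T : topologicalType) (x : T) :
  first_countable T -> exists U, decreasing_base open open x U.
Proof.
move=> /(_ x)[B [/pfcard_geP[B0|[f]] Bx xB]].
  by have [V] := xB _ (@filterT _ (nbhs x) _); rewrite B0.
have fB i : B (f i) by exact: funS.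
exists (fun k => \bigcap_(i < k) (f i)°); split=> [k|j k jk y Uy i ij|V oV Vx].
- split; last by move=> i _; exact/Bx/fB.
  rewrite bigcap_mkord; apply: (big_ind open) => [|V W|i _].
  + exact: openT.
  + exact: openI.
  + exact: open_interior.
- by apply: Uy; exact: leq_trans jk.
- have [W BW WV] := xB V (open_nbhs_nbhs (conj oV Vx)).
  have [i _ fiW] := (@surj _ _ _ _ f) W BW.
  by exists i.+1 => y /(_ i (ltnSn i)); rewrite fiW => /interior_subset/WV.
Qed.

(** * Vietoris bases at finitely generated lower sets *)

Section Main.
Context {d : Order.disp_t} {P : porderType d}.
Implicit Types (B C : Gamma P) (H : set (Gamma P)).

(** The points [x] and [y m] for [n <= m] form a compact set, as [y] converges
    to [x]. Given a directed [D] with supremum [S], a member [B0] of [D] that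
    works for [x] also works for all [y m] with [k <= m], for some [k], since the
    condition is open in the point; the finitely many other [y m] are handled by
    one further member [B1], and an upper bound of [B0] and [B1] works for
    all. *)
Lemma scott_open_sequence H x (y : nat -> P) (n : nat) :
  scott_open H ->
  (forall V : set P, scott_open V -> V x ->
     exists k, forall m, (k <= m)%N -> V (y m)) ->
  scott_open [set B | H (gammaU (down x) B) /\
                      forall m, (n <= m)%N -> H (gammaU (down (y m)) B)].
Proof.
move=> oH yx; apply/scott_openP.
have oHx z : scott_open [set B | H (gammaU (down z) B)].
  exact: scott_open_preimage (gammaU_continuous _) oH.
have oHB B : scott_open [set z | H (gammaU (down z) B)].
  exact: scott_open_preimage (down_gammaU_continuous B) oH.
split=> [B C BC [Hx Hy]|D S dirD lubS [Hx Hy]].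
  have up z : H (gammaU (down z) B) -> H (gammaU (down z) C).
    by have /scott_openP[uH _] := oHx z; exact: uH.
  by split=> [|m nm]; apply: up => //; exact: Hy.
have acc z : H (gammaU (down z) S) -> exists2 B, D B & H (gammaU (down z) B).
  by have /scott_openP[_ +] := oHx z; apply.
have [B0 DB0 HB0] := acc x Hx.
have [k yk] := yx _ (oHB B0) HB0.
pose Q m := [set B | (n <= m)%N -> H (gammaU (down (y m)) B)].
have uQ m B C : B <= C -> Q m B -> Q m C.
  by move=> BC QB nm; have /scott_openP[uH _] := oHx (y m); apply: uH BC (QB nm).
have [m|B1 DB1 HB1] := directed_finite k dirD uQ.
  have [nm|mn] := leqP n m; last first.
    by exists B0 => // nm; move: mn; rewrite ltnNge nm.
  by have [B DB HB] := acc (y m) (Hy m nm); exists B.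
have [_ /(_ B0 B1 DB0 DB1)[B [DB B0B B1B]]] := dirD.
have up z C : C <= B -> H (gammaU (down z) C) -> H (gammaU (down z) B).
  by have /scott_openP[uH _] := oHx z; exact: uH.
exists B => //; split=> [|m nm]; first exact: up HB0.
have [mk|km] := ltnP m k; first exact: up (HB1 m mk nm).
by apply: up B0B _; exact: yk.
Qed.

(** If every [diamond (U k) `&` N k] had a member outside [H], points chosen in
    these members would converge to [x], and [scott_open_sequence] would put
    one of the members into [H]. *)
Lemma gammaU_base x B U N :
  decreasing_base (@scott_open _ P) (@scott_open _ P) x U ->
  decreasing_base (lower_vietoris_topology P) (@scott_open _ (Gamma P)) B N ->
  decreasing_base (lower_vietoris_topology P) (@scott_open _ (Gamma P))
    (gammaU (down x) B) (fun k => diamond (U k) `&` N k).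
Proof.
move=> [Ux dU bU] [NB dN bN]; split=> [k|j k jk C [[y [Cy Uy]] NC]|H oH HxB].
- have [oU Ukx] := Ux k; have [oN NkB] := NB k.
  split.
    by apply: (@openI (vietoris P)) => //; exact: vietoris_open_diamond.
  split; first by exists x; split=> //; left => /=.
  have /scott_openP[uN _] := vietoris_scott_open oN; apply: uN NkB.
  by have := lexx (gammaU (down x) B); rewrite gammaU_le => /andP[].
- by split; [exists y; split=> //; exact: dU jk _ Uy|exact: dN jk _ NC].
- apply: contrapT => nH.
  have /choice[C /all_and2[UNC nHC]] :
      forall k, exists C, (diamond (U k) `&` N k) C /\ ~ H C.
    move=> k; apply: contrapT => nC; apply: nH; exists k => C UNC.
    by apply: contrapT => HC; apply: nC; exists C.
  have /choice[y /all_and2[Cy Uy]] : forall k, exists y, \val (C k) y /\ U k y.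
    by move=> k; have [[y ?] _] := UNC k; exists y.
  have yx (V : set P) : scott_open V -> V x ->
      exists k, forall m, (k <= m)%N -> V (y m).
    move=> oV Vx; have [k UV] := bU V oV Vx; exists k => m km.
    by apply/UV/(dU k m km).
  have [n yn] := yx _ (scott_open_preimage (down_gammaU_continuous B) oH) HxB.
  have [k Nk] := bN _ (scott_open_sequence n oH yx) (conj HxB yn).
  (* At [m := maxn n k] the point [y m] is in the tail covered by
     [scott_open_sequence], and [C m] is in [N m], hence in [N k]. *)
  have [_ Nm] := UNC (maxn n k).
  have [_ /(_ _ (leq_maxl n k)) HC] := Nk _ (dN _ _ (leq_maxr n k) _ Nm).
  apply: (nHC (maxn n k)).
  have /scott_openP[uH _] := oH; apply: uH HC.
  by rewrite gammaU_le lexx andbT; apply/down_le/Cy.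
Qed.

Lemma downs_base (s : seq P) :
  first_countable (scott P) ->
  exists N, decreasing_base (lower_vietoris_topology P)
              (@scott_open _ (Gamma P)) (downs s) N.
Proof.
move=> fcP; elim: s => [|x s [N bN]].
  exists (fun=> setT); split=> [k|//|H /scott_openP[uH _] H0].
    by split=> //; exact: (@openT (vietoris P)).
  by exists 0%N => A _; exact: uH (gamma0_le A) H0.
have [U bU] := first_countable_base (x : scott P) fcP.
by exists (fun k => diamond (U k) `&` N k); exact: gammaU_base bU bN.
Qed.

End Main.

Theorem proposition3p9 (d : Order.disp_t) (P : porderType d) :
  first_countable (scott P) ->
  scott_topology (Gamma P) = lower_vietoris_topology P.
Proof.
move=> fcP; apply/seteqP; split=> H; last exact: vietoris_scott_open.
move=> oH; rewrite /lower_vietoris_topology openE => A HA.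
have [s Hs sA] := scott_open_downs oH HA.
have [N [Ns _ bN]] := downs_base s fcP.
have [k NH] := bN H oH Hs; have [oN Nks] := Ns k.
apply: (@filterS _ (nbhs (A : vietoris P)) _ _ _ NH).
apply: (@open_nbhs_nbhs (vietoris P)); split=> //.
by have /scott_openP[uN _] := vietoris_scott_open oN; exact: uN sA Nks.
Qed.
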